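(* Let $\Gamma$ be a finite undirected graph with vertex set $V$ and $\Omega^1$ its bidirected differential structure. (1) For any bimodule connection $\nabla$ given by data $(\sigma,\alpha)$ and any metric $\mathfrak g$ with coefficients $\{g_{x\to y}\}$, the Laplace-Beltrami operator $\Delta=(\ ,\ )\nabla\mathrm{d}:k(V)\to k(V)$ is the weighted graph Laplacian $$(\Delta f)(x)=\sum_{y:\,x\to y}(f(x)-f(y))\,\gamma_{x,y},\qquad \gamma_{x,y}=g_{y\to x}+\sum_{w:\,x\to w}g_{w\to x}\,\sigma^{x,y,x}_w .$$ (2) $(\ ,\ )\sigma=(\ ,\ )$ if and only if $\sum_{w:\,x\to w}g_{w\to x}\,\sigma^{x,y,x}_w=g_{y\to x}$ for all $x\to y$, and in this case $\gamma_{x,y}=2g_{y\to x}$.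
   Context: $k$ is a field of characteristic not $2$. Graphs have no loops or multiple edges; an undirected graph is viewed as a bidirected digraph, with arrows $x\to y$ and $y\to x$ for every edge. $A=k(V)$ is the algebra of $k$-valued functions on $V$, $\delta_x$ the Kronecker delta function at $x$; $\Omega^1$ is the $A$-$A$-bimodule with $k$-basis $\{\omega_{x\to y}\}$ indexed by all arrows, $f\omega_{x\to y}=f(x)\omega_{x\to y}$, $\omega_{x\to y}f=f(y)\omega_{x\to y}$, $\mathrm{d}f=\sum_{x\to y}(f(y)-f(x))\omega_{x\to y}$; $\bar\otimes=\otimes_A$; $\theta=\sum_{x\to y}\omega_{x\to y}$. Metric: given by arbitrary $g_{x\to y}\in k^*$ for each arrow, $\mathfrak g=\sum_{x\to y}\frac1{g_{x\to y}}\omega_{x\to y}\bar\otimes\omega_{y\to x}$, with inverse the bimodule map $(\ ,\ ):\Omega^1\bar\otimes\Omega^1\to A$, $(\omega_{x\to y},\omega_{y'\to x'})=g_{y\to x}\delta_{x,x'}\delta_{y,y'}\delta_x$. Bimodule connection given by $(\sigma,\alpha)$: $\sigma$ and $\alpha$ are bimodule maps $\sigma(\omega_{x\to y}\bar\otimes\omega_{y\to z})=\sum_{w:\,x\to w\to z}\sigma^{x,y,z}_w\,\omega_{x\to w}\bar\otimes\omega_{w\to z}$ and $\alpha\omega_{x\to y}=\sum_{w:\,x\to w\to y}\alpha^{x,y}_w\,\omega_{x\to w}\bar\otimes\omega_{w\to y}$ with coefficients in $k$, and $\nabla\omega=\theta\bar\otimes\omega-\sigma(\omega\bar\otimes\theta)+\alpha\omega$.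 *)

(* Defs.v *)
From HB Require Import structures.
From mathcomp Require Import all_boot all_order all_algebra.

Set Implicit Arguments.
Unset Strict Implicit.
Unset Printing Implicit Defensive.

Import GRing.Theory.
Local Open Scope ring_scope.

(* All the k(V)-bimodules involved have a finite k-basis of "paths" p, on which
   f in k(V) acts by f p = f(src p) p on the left and p f = f(tgt p) p on the
   right.  Such a basis is a [quiver], and [qmod k Q] is the bimodule, an element
   being given by its coordinates.  The copy k^o of k makes the k-module
   structure on finite functions available. *)

Structure quiver (V : finType) : Type := Quiver {
  qarrow :> finType;
  src : qarrow -> V;
  tgt : qarrow -> V
}.

Notation qmod k Q := {ffun qarrow Q -> k^o}.

Definition lact (k : fieldType) (V : finType) (Q : quiver V)
    (f : {ffun V -> k^o}) (u : qmod k Q) : qmod k Q :=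
  [ffun p => f (src p) * u p].

Definition ract (k : fieldType) (V : finType) (Q : quiver V)
    (u : qmod k Q) (f : {ffun V -> k^o}) : qmod k Q :=
  [ffun p => u p * f (tgt p)].

Definition bimodule_map (k : fieldType) (V : finType) (Q R : quiver V)
    (phi : qmod k Q -> qmod k R) : Prop :=
  [/\ linear phi,
      forall f u, phi (lact f u) = lact f (phi u)
    & forall u f, phi (ract u f) = ract (phi u) f].

(* k(V) as a bimodule over itself. *)
Definition vertices (V : finType) : quiver V := @Quiver V V id id.

Definition delta (k : fieldType) (V : finType) (x : V) : qmod k (vertices V) :=
  [ffun y => (y == x)%:R].

(* Tensor product over k(V): its basis is made of the composable pairs; [tens]
   is proved below to be the universal balanced biadditive map. *)
Definition comp (V : finType) (Q R : quiver V) : quiver V :=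
  @Quiver V {p : Q * R | tgt p.1 == src p.2}
    (fun p => src (val p).1) (fun p => tgt (val p).2).

Definition tens (k : fieldType) (V : finType) (Q R : quiver V)
    (u : qmod k Q) (v : qmod k R) : qmod k (comp Q R) :=
  [ffun p : comp Q R => u (val p).1 * v (val p).2].

(* The arrows of the (bidirected) graph with adjacency relation e. *)
Definition arrows (V : finType) (e : rel V) : quiver V :=
  @Quiver V {a : V * V | e a.1 a.2} (fun a => (val a).1) (fun a => (val a).2).

Notation functions k V := (qmod k (vertices V)).
Notation Omega1 k e := (qmod k (arrows e)).
Notation Omega1xOmega1 k e := (qmod k (comp (arrows e) (arrows e))).

(* Zero, by convention, when x -> y is not an arrow. *)
Definition omega (k : fieldType) (V : finType) (e : rel V) (x y : V) :
    Omega1 k e :=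
  [ffun a => (val a == (x, y))%:R].

Section Calculus.
Context (k : fieldType) (V : finType) (e : rel V).

Local Notation omega := (@omega k V e).

Definition theta : Omega1 k e := \sum_x \sum_(y | e x y) omega x y.

Definition dif (f : functions k V) : Omega1 k e :=
  \sum_x \sum_(y | e x y) (f y - f x) *: omega x y.

(* Only the values of g on arrows matter, here and in [pairing]. *)
Definition metric (g : V -> V -> k) : Omega1xOmega1 k e :=
  \sum_x \sum_(y | e x y) (g x y)^-1 *: tens (omega x y) (omega y x).

(* The map ( , ): the linear map sending the basis path x -> y -> z
   to g_{y -> x} delta_x if z = x, and to 0 otherwise. *)
Definition pairing (g : V -> V -> k) (U : Omega1xOmega1 k e) :
    functions k V :=
  \sum_(p : comp (arrows e) (arrows e) | tgt p == src p)
    (U p * g (tgt (val p).1) (src p)) *: delta k (src p).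

Definition sigma_coeffs (sigma : Omega1xOmega1 k e -> Omega1xOmega1 k e)
    (s : V -> V -> V -> V -> k) : Prop :=
  forall x y z, e x y -> e y z ->
    sigma (tens (omega x y) (omega y z)) =
      \sum_(w | e x w && e w z) s x y z w *: tens (omega x w) (omega w z).

Definition alpha_coeffs (alpha : Omega1 k e -> Omega1xOmega1 k e)
    (a : V -> V -> V -> k) : Prop :=
  forall x y, e x y ->
    alpha (omega x y) =
      \sum_(w | e x w && e w y) a x y w *: tens (omega x w) (omega w y).

Definition nabla (sigma : Omega1xOmega1 k e -> Omega1xOmega1 k e)
    (alpha : Omega1 k e -> Omega1xOmega1 k e) (u : Omega1 k e) :
    Omega1xOmega1 k e :=
  tens theta u - sigma (tens u theta) + alpha u.

Definition laplace_beltrami (g : V -> V -> k)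
    (sigma : Omega1xOmega1 k e -> Omega1xOmega1 k e)
    (alpha : Omega1 k e -> Omega1xOmega1 k e) (f : functions k V) :
    functions k V :=
  pairing g (nabla sigma alpha (dif f)).

Definition gamma (g : V -> V -> k) (s : V -> V -> V -> V -> k) (x y : V) : k :=
  g y x + \sum_(w | e x w) g w x * s x y x w.

End Calculus.

Section Tensor.
Context (k : fieldType) (V : finType) (Q R : quiver V).

Local Notation basis := (fun q => [ffun p => (p == q)%:R]).

Lemma qmod_basis (S : quiver V) (u : qmod k S) :
  u = \sum_q u q *: (basis q : qmod k S).
Proof.
apply/ffunP=> p; rewrite sum_ffunE (bigD1 p) //= !ffunE eqxx /GRing.scale /= mulr1.
rewrite big1 ?addr0 // => q; rewrite !ffunE eq_sym => /negPf -> /=.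
by rewrite /GRing.scale /= mulr0.
Qed.

Lemma tens_balanced (u : qmod k Q) (f : {ffun V -> k^o}) (v : qmod k R) :
  tens (ract u f) v = tens u (lact f v).
Proof.
apply/ffunP=> p; rewrite !ffunE (eqP (valP p)) /=.
exact: esym (mulrA _ _ _).
Qed.

(* [tens] has the universal property of the tensor product over k(V). *)
Lemma tens_universal (B : zmodType) (b : qmod k Q -> qmod k R -> B)
    (bDl : forall u u' v, b (u + u') v = b u v + b u' v)
    (bDr : forall u v v', b u (v + v') = b u v + b u v')
    (b_bal : forall u f v, b (ract u f) v = b u (lact f v)) :
  exists2 h : qmod k (comp Q R) -> B,
    {morph h : U U' / U + U'} & forall u v, h (tens u v) = b u v.
Proof.
have b0l v : b 0 v = 0 by apply: (addrI (b 0 v)); rewrite -bDl !addr0.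
have b0r u : b u 0 = 0 by apply: (addrI (b u 0)); rewrite -bDr !addr0.
pose eQ (q : Q) : qmod k Q := [ffun p => (p == q)%:R].
pose eR (r : R) : qmod k R := [ffun p => (p == r)%:R].
exists (fun U => \sum_(p : comp Q R) b (U p *: eQ (val p).1) (eR (val p).2)).
  move=> U U'; rewrite -big_split /=; apply: eq_bigr => p _.
  by rewrite ffunE scalerDl bDl.
move=> u v.
pose F (p : Q * R) := b ((u p.1 * v p.2 : k) *: eQ p.1) (eR p.2).
transitivity (\sum_(p : Q * R | tgt p.1 == src p.2) F p).
  rewrite [RHS](reindex_omap (val : comp Q R -> _) insub) /=; last first.
    by move=> p ?; rewrite insubT.
  apply: eq_big => [p|p _]; last by rewrite /F ffunE.
  by rewrite (valP p) /= valK eqxx.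
rewrite [in RHS](qmod_basis u) [in RHS](qmod_basis v).
rewrite (big_morph (fun u => b u _) (fun x y => bDl x y _) (b0l _)).
under [RHS]eq_bigr do rewrite (big_morph (b _) (bDr _) (b0r _)).
rewrite pair_big /= big_mkcond /=; apply: eq_bigr => -[q r] _ /=.
have -> : [ffun p => (p == q)%:R] = eQ q by [].
have -> : [ffun p => (p == r)%:R] = eR r by [].
case: eqP => [_|/eqP qr].
  rewrite /F /=.
  have -> : (u q * v r : k) *: eQ q = ract (u q *: eQ q) [ffun=> v r].
    apply/ffunP=> p; rewrite !ffunE /GRing.scale /=.
    by rewrite mulrAC.
  rewrite b_bal; congr (b _ _).
  by apply/ffunP=> p; rewrite !ffunE.
have -> : u q *: eQ q = ract (u q *: eQ q) (delta k (tgt q)).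
  apply/ffunP=> p; rewrite !ffunE.
  by case: (p =P q) => [->|_]; rewrite ?eqxx ?mulr1 // scaler0 mul0r.
rewrite b_bal.
have -> : lact (delta k (tgt q)) (v r *: eR r) = 0; last by rewrite b0r.
apply/ffunP=> p; rewrite !ffunE.
case: (p =P r) => [->|_]; last by rewrite scaler0 mulr0.
by rewrite eq_sym (negPf qr) mul0r.
Qed.

Lemma tens_generates (B : zmodType) (h h' : qmod k (comp Q R) -> B)
    (hD : {morph h : U U' / U + U'}) (h'D : {morph h' : U U' / U + U'}) :
  (forall u v, h (tens u v) = h' (tens u v)) -> h =1 h'.
Proof.
move=> hh' U; rewrite (qmod_basis U).
have h0 : h 0 = 0 by apply: (addrI (h 0)); rewrite -hD !addr0.
have h'0 : h' 0 = 0 by apply: (addrI (h' 0)); rewrite -h'D !addr0.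
rewrite (big_morph h hD h0) (big_morph h' h'D h'0); apply: eq_bigr => q _.
have -> : U q *: [ffun p => (p == q)%:R] =
    tens (U q *: [ffun p => (p == (val q).1)%:R])
         [ffun p => (p == (val q).2)%:R]; last exact: hh'.
apply/ffunP=> p; rewrite !ffunE -mulrA -natrM mulnb.
by rewrite -val_eqE /=; congr (_ * (nat_of_bool _)%:R); case: (val p); case: (val q).
Qed.

End Tensor.

Section Checks.
Context (k : fieldType) (V : finType) (e : rel V).
Local Notation omega := (@omega k V e).

Lemma big_arrows (B : nmodType) (F : V -> V -> B) :
  \sum_x \sum_(y | e x y) F x y =
    \sum_(a : arrows e) F (src a) (tgt a).
Proof.
rewrite pair_big_dep /= (reindex_omap (val : arrows e -> _) insub) /=; last first.
  by move=> p ?; rewrite insubT.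
by apply: eq_bigl => a; rewrite (valP a) /= valK eqxx.
Qed.

Lemma arrows_sum (c : V -> V -> k) (a : arrows e) :
  (\sum_x \sum_(y | e x y) c x y *: omega x y : Omega1 k e) a
    = c (src a) (tgt a).
Proof.
rewrite (big_arrows (fun x y => c x y *: omega x y)) sum_ffunE (bigD1 a) //=.
rewrite !ffunE -surjective_pairing eqxx /GRing.scale /= mulr1.
rewrite big1 ?addr0 // => b ba; rewrite !ffunE -surjective_pairing.
by rewrite val_eqE eq_sym (negPf ba) scaler0.
Qed.

Lemma thetaE (a : arrows e) : theta k e a = 1.
Proof.
rewrite -(arrows_sum (fun _ _ => 1) a); congr (fun_of_fin _ _).
by do 2!apply: eq_bigr => ? _; rewrite scale1r.
Qed.

Lemma difE (f : functions k V) (a : arrows e) : dif e f a = f (tgt a) - f (src a).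
Proof. exact: arrows_sum (fun x y => f y - f x) a. Qed.

(* [nabla] is indeed a bimodule connection, with generalised braiding sigma. *)
Lemma nabla_lact sigma alpha (f : functions k V) (u : Omega1 k e) :
  bimodule_map sigma -> bimodule_map alpha ->
  nabla sigma alpha (lact f u) =
    tens (dif e f) u + lact f (nabla sigma alpha u).
Proof.
case=> _ sl _ [_ al _]; rewrite /nabla al.
have -> : tens (lact f u) (theta k e) = lact f (tens u (theta k e)).
  by apply/ffunP=> p; rewrite !ffunE mulrA.
rewrite sl; apply/ffunP=> p; rewrite !ffunE difE !thetaE (eqP (valP p)) /=.
by rewrite !mul1r !mulrDr !addrA mulrN mulrBl subrK.
Qed.

Lemma nabla_ract sigma alpha (f : functions k V) (u : Omega1 k e) :
  bimodule_map sigma -> bimodule_map alpha ->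
  nabla sigma alpha (ract u f) =
    ract (nabla sigma alpha u) f + sigma (tens u (dif e f)).
Proof.
case=> slin _ sr [_ _ ar]; rewrite /nabla ar.
have -> : tens u (dif e f) =
    (-1) *: tens (ract u f) (theta k e) + ract (tens u (theta k e)) f.
  apply/ffunP=> p; rewrite !ffunE difE !thetaE (eqP (valP p)) /= scaleN1r.
  by rewrite !mulr1 mulrBr addrC.
rewrite slin sr; apply/ffunP=> p; rewrite !ffunE scaleN1r !mulrDl mulNr.
rewrite mulrA.
by rewrite [in RHS](addrC (- _)) addrA [X in _ = X + _ - _]addrAC subrK addrAC.
Qed.

(* [pairing] is the bimodule map ( , ), given on basis elements, and is inverse
   to [metric]: contracting the latter with it on either side is the identity. *)
Lemma pairing_bimodule_map (g : V -> V -> k) : bimodule_map (pairing (e := e) g).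
Proof.
split=> [c U U'|f U|U f].
- rewrite scaler_sumr -big_split; apply: eq_bigr => p _ /=.
  by rewrite !ffunE mulrDl scalerDl scalerA mulrA.
- apply/ffunP=> x; rewrite !ffunE !sum_ffunE mulr_sumr; apply: eq_bigr => p _.
  rewrite !ffunE /GRing.scale /=; case: eqP => [->|_]; last by rewrite !mulr0.
  by rewrite !mulrA.
- apply/ffunP=> x; rewrite !ffunE !sum_ffunE mulr_suml.
  apply: eq_bigr => p /eqP tp.
  rewrite !ffunE tp /GRing.scale /=; case: eqP => [->|_].
    by rewrite !mulr1 mulrAC.
  by rewrite !mulr0 mul0r.
Qed.

Lemma pairing_omegar (g : V -> V -> k) (u : Omega1 k e) (a : arrows e) :
  e (tgt a) (src a) ->
  pairing g (tens u (omega (tgt a) (src a))) =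
    (u a * g (tgt a) (src a)) *: delta k (src a).
Proof.
move=> ea; pose r : arrows e := Sub (tgt a, src a) ea.
have cp : tgt a == src r by [].
rewrite /pairing (bigD1 (Sub (a, r) cp : comp _ _)) //=.
rewrite ffunE /= ffunE eqxx mulr1 big1 ?addr0 // => -[[b c] /= bc] /andP[bcs].
rewrite -val_eqE /= => ne; rewrite !ffunE /=.
case: eqP => [cE|]; last by rewrite mulr0 mul0r scale0r.
case/negP: ne; apply/eqP; move: bc bcs; rewrite /= cE /= => /eqP b2 /eqP b1.
by congr pair; apply: val_inj; rewrite //= (surjective_pairing (val b)) b2 -b1 -surjective_pairing.
Qed.

Lemma pairing_omegal (g : V -> V -> k) (u : Omega1 k e) (a : arrows e) :
  e (tgt a) (src a) ->
  pairing g (tens (omega (tgt a) (src a)) u) =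
    (u a * g (src a) (tgt a)) *: delta k (tgt a).
Proof.
move=> ea; pose r : arrows e := Sub (tgt a, src a) ea.
have cp : tgt r == src a by [].
rewrite /pairing (bigD1 (Sub (r, a) cp : comp _ _)) //=.
rewrite ffunE /= ffunE eqxx mul1r big1 ?addr0 // => -[[b c] /= bc] /andP[bcs].
rewrite -val_eqE /= => ne; rewrite !ffunE /=.
case: eqP => [bE|]; last by rewrite !mul0r scale0r.
case/negP: ne; apply/eqP; move: bc bcs; rewrite /= bE /= => /eqP c1 /eqP c2.
by congr pair; apply: val_inj; rewrite //= (surjective_pairing (val c)) c2 -c1 -surjective_pairing.
Qed.

Lemma pairing_omega (g : V -> V -> k) (x y y' x' : V) :
  symmetric e -> e x y -> e y' x' ->
  pairing g (tens (omega x y) (omega y' x')) =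
    (g y x * (x == x')%:R * (y == y')%:R) *: delta k x.
Proof.
move=> esym xy yx'; have xy' : e x' y' by rewrite esym.
rewrite (pairing_omegar g (omega x y) (a := Sub (x', y') xy' : arrows e)) //=.
rewrite ffunE /= xpair_eqE (eq_sym x') (eq_sym y').
by case: eqP => [->|_]; case: eqP => [->|_] /=;
  rewrite ?mul1r ?mulr1 ?mul0r ?mulr0 ?mul0r ?scale0r.
Qed.

Lemma metric_pairingl (g : V -> V -> k) (u : Omega1 k e) :
  symmetric e -> (forall x y, e x y -> g x y != 0) ->
  \sum_x \sum_(y | e x y)
     (g x y)^-1 *: lact (pairing g (tens u (omega x y))) (omega y x) = u.
Proof.
move=> esym g0; rewrite (exchange_big_dep predT) //=.
under eq_bigr do under eq_bigl do rewrite esym.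
rewrite (big_arrows (fun y x =>
  (g x y)^-1 *: lact (pairing g (tens u (omega x y))) (omega y x))).
rewrite [RHS]qmod_basis; apply: eq_bigr => a _.
have ea : e (tgt a) (src a) by rewrite esym; apply: (valP a).
rewrite pairing_omegar //; apply/ffunP=> b; rewrite !ffunE.
rewrite -surjective_pairing val_eqE.
case: (b =P a) => [->|_]; last by rewrite mulr0 !scaler0.
by rewrite eqxx /GRing.scale /= !mulr1 mulrC mulfK // g0.
Qed.

Lemma metric_pairingr (g : V -> V -> k) (u : Omega1 k e) :
  symmetric e -> (forall x y, e x y -> g x y != 0) ->
  \sum_x \sum_(y | e x y)
     (g x y)^-1 *: ract (omega x y) (pairing g (tens (omega y x) u)) = u.
Proof.
move=> esym g0.
rewrite (big_arrows (fun x y =>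
  (g x y)^-1 *: ract (omega x y) (pairing g (tens (omega y x) u)))).
rewrite [RHS]qmod_basis; apply: eq_bigr => a _.
have ea : e (tgt a) (src a) by rewrite esym; apply: (valP a).
rewrite pairing_omegal //; apply/ffunP=> b; rewrite !ffunE.
rewrite -surjective_pairing val_eqE.
case: (b =P a) => [->|_]; last by rewrite mul0r !scaler0.
by rewrite eqxx /GRing.scale /= mul1r !mulr1 mulrC mulfK // g0 //; apply: (valP a).
Qed.

(* Bimodule maps always have coefficients as in [sigma_coeffs], [alpha_coeffs]. *)
Lemma paths_sum (U : Omega1xOmega1 k e) (x z : V) :
  lact (delta k x) U = U -> ract U (delta k z) = U ->
  U = \sum_(w | e x w && e w z)
        (\sum_(p : comp (arrows e) (arrows e) |
            (val (val p).1 == (x, w)) && (val (val p).2 == (w, z))) U p) *: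
        tens (omega x w) (omega w z).
Proof.
move=> Ux Uz; apply/ffunP=> p; rewrite sum_ffunE.
have [/andP[/eqP sx /eqP tz]|npxz] := boolP ((src p == x) && (tgt p == z)).
  set m := tgt (val p).1.
  have p1 : val (val p).1 = (x, m) by rewrite -sx -surjective_pairing.
  have p2 : val (val p).2 = (m, z).
    by rewrite -tz /m (eqP (valP p)) -surjective_pairing.
  have exz : e x m && e m z.
    by have := valP (val p).1; have := valP (val p).2; rewrite /= p1 p2 /= => -> ->.
  rewrite (bigD1 m) //= !ffunE p1 p2 !eqxx mulr1.
  rewrite (big_pred1 p) => [|q] /=; last first.
    by rewrite -p1 -p2 !val_eqE -xpair_eqE -!surjective_pairing val_eqE.
  rewrite /GRing.scale /= mulr1 big1 ?addr0 // => w /andP[_ wm].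
  by rewrite !ffunE p1 xpair_eqE (eq_sym m) (negPf wm) andbF mul0r scaler0.
rewrite -Ux -Uz !ffunE big1 => [|w _].
  by case/nandP: npxz => /negPf ->; rewrite ?mulr0 ?mul0r.
rewrite !ffunE; case: eqP => [p1|]; last by rewrite mul0r scaler0.
case: eqP => [p2|]; last by rewrite mulr0 scaler0.
by move: npxz; rewrite /= p1 p2 /= !eqxx.
Qed.

Lemma lact_tens (x y : V) (v : Omega1 k e) :
  lact (delta k x) (tens (omega x y) v) = tens (omega x y) v.
Proof.
apply/ffunP=> p; rewrite !ffunE.
case: (val (val p).1 =P (x, y)) => [p1|]; last by rewrite mul0r mulr0.
by rewrite /= p1 eqxx !mul1r.
Qed.

Lemma ract_tens (y z : V) (u : Omega1 k e) :
  ract (tens u (omega y z)) (delta k z) = tens u (omega y z).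
Proof.
apply/ffunP=> p; rewrite !ffunE.
case: (val (val p).2 =P (y, z)) => [p1|]; last by rewrite mulr0 mul0r.
by rewrite /= p1 eqxx !mulr1.
Qed.

Lemma sigma_coeffs_exist (sigma : Omega1xOmega1 k e -> Omega1xOmega1 k e) :
  bimodule_map sigma -> exists s, sigma_coeffs sigma s.
Proof.
case=> _ sl sr; eexists (fun x y z w => _) => x y z _ _; apply: paths_sum.
  by rewrite -sl lact_tens.
by rewrite -sr ract_tens.
Qed.

Lemma alpha_coeffs_exist (alpha : Omega1 k e -> Omega1xOmega1 k e) :
  bimodule_map alpha -> exists a, alpha_coeffs alpha a.
Proof.
case=> _ al ar; eexists (fun x y w => _) => x y _; apply: paths_sum.
  rewrite -al; congr alpha; apply/ffunP=> a; rewrite !ffunE.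
  by case: (val a =P (x, y)) => [aE|]; rewrite ?mulr0 //= aE eqxx mul1r.
rewrite -ar; congr alpha; apply/ffunP=> a; rewrite !ffunE.
by case: (val a =P (x, y)) => [aE|]; rewrite ?mul0r //= aE eqxx mulr1.
Qed.

End Checks.

(* Main.v *)
From HB Require Import structures.
Require Import Defs.
From mathcomp Require Import all_boot all_order all_algebra.

Set Implicit Arguments.
Unset Strict Implicit.
Unset Printing Implicit Defensive.

Import GRing.Theory.
Local Open Scope ring_scope.

(** A bimodule map phi into k(V) only sees loops: evaluation at x satisfies
    phi(U)(x) = (delta_x phi(U) delta_x)(x) = phi(delta_x U delta_x)(x), and
    delta_x U delta_x keeps exactly the components of U on paths from x to x.

    In degree one there are no loops since the graph has none, so the
    contribution ( , ) alpha of alpha to the Laplacian vanishes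
    ([bimodule_map_Omega1]).  In degree two the loops at x are the paths
    x -> y -> x, so phi is determined by its values on
    omega_{x->y} (x) omega_{y->x} ([bimodule_map_loops]).  These values are
    g_{y->x} for phi = ( , ) and the sum over w of g_{w->x} sigma^{x,y,x}_w for
    phi = ( , ) sigma.  Comparing them is the criterion for
    ( , ) sigma = ( , ), while the Laplacian formula results from the
    components of theta (x) df and df (x) theta on x -> y -> x, which are
    f(x) - f(y) and f(y) - f(x) respectively. *)

Section BimoduleMaps.
Context (k : fieldType) (V : finType).

(** Gives access to the theory of linear maps for the unbundled notion. *)
Lemma bimodule_map_linear (Q R : quiver V) (phi : qmod k Q -> qmod k R) :
  bimodule_map phi ->
  exists L : {linear qmod k Q -> qmod k R}, phi = L.
Proof.
case=> lin _ _.
pose lin' := GRing.isLinear.Build k (qmod k Q) (qmod k R) *:%R phi lin.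
pose L : {linear qmod k Q -> qmod k R} := HB.pack phi lin'.
by exists L.
Qed.

Lemma bimodule_map_comp (Q R S : quiver V)
    (phi : qmod k Q -> qmod k R) (psi : qmod k R -> qmod k S) :
  bimodule_map phi -> bimodule_map psi -> bimodule_map (psi \o phi).
Proof.
move=> [fD fl fr] [gD gl gr]; split=> [c u v|f u|u f] /=.
- by rewrite fD gD.
- by rewrite fl gl.
- by rewrite fr gr.
Qed.

(** The two actions of k(V) on itself agree, so sandwiching by delta_x does not
    change the value at x. *)
Lemma bimodule_map_at (Q : quiver V) (phi : qmod k Q -> functions k V)
    (u : qmod k Q) (x : V) :
  bimodule_map phi ->
  phi u x = phi (lact (delta k x) (ract u (delta k x))) x.
Proof. by case=> _ fl fr; rewrite fl fr !ffunE eqxx mul1r mulr1. Qed.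

End BimoduleMaps.

Section Loops.
Context (k : fieldType) (V : finType) (e : rel V).
Local Notation omega := (@omega k V e).

(** No arrow has equal ends, so delta_x u delta_x = 0 for every x. *)
Lemma bimodule_map_Omega1 (phi : Omega1 k e -> functions k V)
    (u : Omega1 k e) :
  irreflexive e -> bimodule_map phi -> phi u = 0.
Proof.
move=> eirr phib; apply/ffunP=> x; rewrite (bimodule_map_at u x phib).
suff -> : lact (delta k x) (ract u (delta k x)) = 0.
  by have [L ->] := bimodule_map_linear phib; rewrite linear0.
apply/ffunP=> a; rewrite !ffunE.
case: eqP => [sx|_]; last by rewrite mul0r.
case: eqP => [tx|_]; last by rewrite !mulr0.
by have := valP a; rewrite /= in sx tx *; rewrite sx tx eirr.
Qed.

(** The coordinate of U on x -> y -> x; the sum has a single term when x -> y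
    and y -> x are arrows, and makes the coordinate total in x and y. *)
Definition loop_coef (U : Omega1xOmega1 k e) (x y : V) : k :=
  \sum_(p : Defs.comp (arrows e) (arrows e) |
        (val (val p).1 == (x, y)) && (val (val p).2 == (y, x))) U p.

Lemma loop_coef_tens (c d : V -> V -> k) (u v : Omega1 k e) (x y : V) :
  (forall a, u a = c (src a) (tgt a)) -> (forall a, v a = d (src a) (tgt a)) ->
  e x y -> e y x -> loop_coef (tens u v) x y = c x y * d y x.
Proof.
move=> uE vE xy yx.
pose b1 : arrows e := Sub (x, y) xy; pose b2 : arrows e := Sub (y, x) yx.
have b12 : tgt b1 == src b2 by [].
rewrite /loop_coef (big_pred1 (Sub (b1, b2) b12 : Defs.comp _ _)) => [|p].
  by rewrite ffunE uE vE.
by rewrite /= -[in RHS]val_eqE /= [RHS]xpair_eqE.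
Qed.

(** delta_x U delta_x is the part of U on paths x -> y -> x; on it, [paths_sum]
    yields the coordinates, which are unchanged by the two factors delta_x. *)
Lemma bimodule_map_loops (phi : Omega1xOmega1 k e -> functions k V)
    (U : Omega1xOmega1 k e) (x : V) :
  symmetric e -> bimodule_map phi ->
  phi U x = \sum_(y | e x y)
              loop_coef U x y * phi (tens (omega x y) (omega y x)) x.
Proof.
move=> esym phib; rewrite (bimodule_map_at U x phib).
set U' := lact _ _.
have lU' : lact (delta k x) U' = U'.
  by apply/ffunP=> p; rewrite !ffunE; case: eqP; rewrite ?mul1r ?mul0r.
have rU' : ract U' (delta k x) = U'.
  by apply/ffunP=> p; rewrite !ffunE; case: (tgt _ =P x); rewrite ?mulr1 ?mulr0.
rewrite (paths_sum lU' rU').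
have [L ->] := bimodule_map_linear phib.
rewrite linear_sum sum_ffunE.
apply: eq_big => [y|y _]; first by rewrite (esym y) andbb.
rewrite linearZ ffunE; congr (_ * _).
apply: eq_bigr => p /andP[/eqP p1 /eqP p2].
by rewrite !ffunE /= p1 p2 eqxx mul1r mulr1.
Qed.

Lemma pairing_loop (g : V -> V -> k) (x y : V) :
  symmetric e -> e x y ->
  pairing g (tens (omega x y) (omega y x)) = g y x *: delta k x.
Proof.
by move=> esym xy; rewrite pairing_omega // 1?esym // !eqxx !mulr1.
Qed.

(** sigma preserves the ends of a path, so the image of a loop is again a
    combination of loops x -> w -> x, each of which [pairing_loop] evaluates. *)
Lemma pairing_sigma_loop (g : V -> V -> k)
    (sigma : Omega1xOmega1 k e -> Omega1xOmega1 k e)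
    (s : V -> V -> V -> V -> k) (x y : V) :
  symmetric e -> sigma_coeffs sigma s -> e x y ->
  pairing g (sigma (tens (omega x y) (omega y x))) =
    (\sum_(w | e x w) g w x * s x y x w) *: delta k x.
Proof.
move=> esym sE xy; rewrite sE // 1?esym //.
have [L LE] := bimodule_map_linear (pairing_bimodule_map e g).
rewrite LE linear_sum scaler_suml -LE.
apply: eq_big => [w|w /andP[xw _]]; first by rewrite (esym w) andbb.
by rewrite LE linearZ /= -LE pairing_loop // scalerA mulrC.
Qed.

End Loops.

Theorem proposition3p7
    (k : fieldType) (char_neq2 : 2%N \notin [pchar k])
    (V : finType) (e : rel V) (e_sym : symmetric e) (e_irr : irreflexive e)
    (g : V -> V -> k) (g_neq0 : forall x y, e x y -> g x y != 0)
    (sigma : Omega1xOmega1 k e -> Omega1xOmega1 k e)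
    (s : V -> V -> V -> V -> k)
    (sigma_bimod : bimodule_map sigma) (sigmaE : sigma_coeffs sigma s)
    (alpha : Omega1 k e -> Omega1xOmega1 k e)
    (a : V -> V -> V -> k)
    (alpha_bimod : bimodule_map alpha) (alphaE : alpha_coeffs alpha a) :
  (forall (f : functions k V) (x : V),
     laplace_beltrami g sigma alpha f x =
       \sum_(y | e x y) (f x - f y) * gamma e g s x y)
  /\
  ((forall U, pairing g (sigma U) = pairing g U) <->
   (forall x y, e x y -> \sum_(w | e x w) g w x * s x y x w = g y x))
  /\
  ((forall U, pairing g (sigma U) = pairing g U) ->
   forall x y, e x y -> gamma e g s x y = 2%:R * g y x).
Proof.
pose pair := pairing (e := e) g.
have pairb : bimodule_map pair := pairing_bimodule_map e g.
have psb : bimodule_map (pair \o sigma) := bimodule_map_comp sigma_bimod pairb.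
have pair_val x y : e x y ->
    pair (tens (omega k e x y) (omega k e y x)) x = g y x.
  by move=> xy; rewrite /pair pairing_loop // !ffunE eqxx /GRing.scale /= mulr1.
have sigma_val x y : e x y ->
    (pair \o sigma) (tens (omega k e x y) (omega k e y x)) x =
      \sum_(w | e x w) g w x * s x y x w.
  move=> xy; rewrite /pair /= (pairing_sigma_loop _ _ sigmaE) //.
  by rewrite !ffunE eqxx /GRing.scale /= mulr1.
have crit : (forall U, pair (sigma U) = pair U) <->
    (forall x y, e x y -> \sum_(w | e x w) g w x * s x y x w = g y x).
  split=> [psE x y xy|sE U]; first by rewrite -sigma_val //= psE pair_val.
  apply/ffunP=> x; rewrite (bimodule_map_loops U x e_sym pairb).
  rewrite -[pair (sigma U)]/((pair \o sigma) U) (bimodule_map_loops U x e_sym psb).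
  by apply: eq_bigr => y xy; rewrite sigma_val // pair_val // sE.
split; last first.
  split=> // /crit sE x y xy.
  by rewrite /gamma sE // -mulr2n mulr_natl.
move=> f x; rewrite /laplace_beltrami -/pair /nabla.
pose c1 (_ _ : V) : k := 1; pose df (y z : V) : k := f z - f y.
have theta_c1 b : theta k e b = c1 (src b) (tgt b) := thetaE k b.
have dif_df b : dif e f b = df (src b) (tgt b) := difE f b.
have [L LE] := bimodule_map_linear pairb.
rewrite LE linearD linearB -LE.
have -> : pair (alpha (dif e f)) = 0.
  exact: (bimodule_map_Omega1 _ e_irr (bimodule_map_comp alpha_bimod pairb)).
rewrite addr0 !ffunE (bimodule_map_loops _ x e_sym pairb).
rewrite -[pair (sigma _)]/((pair \o sigma) _) (bimodule_map_loops _ x e_sym psb).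
rewrite -sumrB; apply: eq_bigr => y xy.
have yx : e y x by rewrite e_sym.
rewrite sigma_val // pair_val //.
rewrite (loop_coef_tens theta_c1 dif_df) // (loop_coef_tens dif_df theta_c1) //.
by rewrite mul1r mulr1 /df /gamma mulrDr -mulNr opprB.
Qed.
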